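(* Let $(S,+,\cdot,-,\ast)$ be a dual weak left $\star$-brace and $z\in S$. Define $r^S_z: S\times S\to S\times S$ by $$r^S_z(a,b)=\left(\sigma^z_a(b),\ \tau^z_b(a)\right),\qquad \sigma_a^{z}(b) =z^\ast z (-a z+a b z)z^\ast z,\qquad \tau_b^{z}(a) =(\sigma_a^{z}(b))^\ast ab,$$ for all $a,b\in S$. Then $r^S_z$ is a solution of the Yang-Baxter equation if and only if $z\in \mathcal{D}_r(S)$.
   Context: A regular $\star$-semigroup $(S,\cdot,\ast)$ is a semigroup $(S,\cdot)$ with a unary operation $x\mapsto x^\ast$ satisfying $xx^\ast x=x$, $(x^\ast)^\ast=x$, $(xy)^\ast=y^\ast x^\ast$ for all $x,y\in S$. A weak left $\star$-brace $(S,+,\cdot,-,\ast)$ consists of a set $S$ such that $(S,+,-)$ and $(S,\cdot,\ast)$ are regular $\star$-semigroups (with unary operations $x\mapsto -x$ and $x\mapsto x^\ast$ respectively; $+$ need not be commutative) and $x(y+z)=xy-x+xz$ and $-x+x=xx^\ast$ for all $x,y,z\in S$. Here $xy=x\cdot y$, $x-y$ means $x+(-y)$, and multiplication has higher precedence than addition. It is a dual weak left $\star$-brace if moreover $x-x=x^\ast x$ for all $x\in S$. The set of right distributors of a dual weak left $\star$-brace $S$ is $\mathcal{D}_r(S)=\{z\in S\mid (a+b)z=az-z+bz \text{ for all } a,b\in S\}$. A map $r:S\times S\to S\times S$ is a (set-theoretic) solution of the Yang-Baxter equation if $(r\times \mathrm{id}_S)(\mathrm{id}_S\times r)(r\times \mathrm{id}_S)=(\mathrm{id}_S\times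 r)(r\times \mathrm{id}_S)(\mathrm{id}_S\times r)$ as maps $S\times S\times S\to S\times S\times S$; no bijectivity or non-degeneracy is required. *)

(* Defs.v *)
From mathcomp Require Import ssreflect ssrfun ssrbool.

Set Implicit Arguments.
Unset Strict Implicit.
Unset Printing Implicit Defensive.

Record regular_star_semigroup (S : Type) (op : S -> S -> S) (star : S -> S)
    : Prop := RegularStarSemigroup {
  rss_assoc : associative op;
  rss_regular : forall x, op (op x (star x)) x = x;
  rss_involutive : involutive star;
  rss_antimorph : forall x y, star (op x y) = op (star y) (star x)
}.

Declare Scope brace_scope.
Delimit Scope brace_scope with brace.

(* Neither operation is assumed commutative. *)
Record weak_left_star_brace : Type := WeakLeftStarBrace {
  brace_sort :> Type;
  badd : brace_sort -> brace_sort -> brace_sort;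
  bmul : brace_sort -> brace_sort -> brace_sort;
  bopp : brace_sort -> brace_sort;
  bstar : brace_sort -> brace_sort;
  badd_rss : regular_star_semigroup badd bopp;
  bmul_rss : regular_star_semigroup bmul bstar;
  bmul_addr : forall x y z,
    bmul x (badd y z) = badd (badd (bmul x y) (bopp x)) (bmul x z);
  baddN_mulstar : forall x, badd (bopp x) x = bmul x (bstar x)
}.

Notation "x + y" := (badd x y) : brace_scope.
Notation "- x" := (bopp x) : brace_scope.
Notation "x - y" := (badd x (bopp y)) : brace_scope.
Notation "x * y" := (bmul x y) : brace_scope.
Notation "x ^*" := (bstar x) : brace_scope.

Local Open Scope brace_scope.

Record dual_weak_left_star_brace : Type := DualWeakLeftStarBrace {
  dual_brace :> weak_left_star_brace;
  dual_brace_axiom : forall x : dual_brace, x - x = x^* * x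
}.

Definition right_distributor (S : weak_left_star_brace) (z : S) : Prop :=
  forall a b : S, (a + b) * z = a * z - z + b * z.

Section YangBaxter.

Variables (T : Type) (r : T * T -> T * T).

(* [r x id] and [id x r], on T * T * T = (T * T) * T. *)
Definition ybe_left (t : T * T * T) : T * T * T :=
  let: (a, b, c) := t in let: (x, y) := r (a, b) in (x, y, c).

Definition ybe_right (t : T * T * T) : T * T * T :=
  let: (a, b, c) := t in let: (x, y) := r (b, c) in (a, x, y).

Definition yang_baxter_solution : Prop :=
  ybe_left \o ybe_right \o ybe_left =1 ybe_right \o ybe_left \o ybe_right.

End YangBaxter.

Section DeformedMap.

Variables (S : dual_weak_left_star_brace) (z : S).

(* Unary minus binds tighter than multiplication in Rocq, whereas the
   mathematical "- a z" means the additive inverse of the product a z. *)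
Definition sigma (a b : S) : S :=
  z^* * z * (- (a * z) + a * b * z) * z^* * z.

Definition tau (b a : S) : S := (sigma a b)^* * a * b.

Definition deformed_map (p : S * S) : S * S :=
  let: (a, b) := p in (sigma a b, tau b a).

End DeformedMap.

(* Main.v *)
(** A projection is an element of the form [- x + x = x x^*].  For a projection
    [e] one has [e y = y + e] and [y e = e + y]; together with left
    distributivity this lets a projection in the interior of a sum move past
    every neighbour.  Hence [x |-> e x e] is a homomorphism for all four
    operations, and the elements with [x - x = e = - x + x] form a skew left
    brace, in which the theorem is a computation with groups.  An element of
    the form [f + t + g] is recovered from [e t e] as soon as [e] lies under
    [t] and [t] under [e] in the semilattice of interior projections; all
    identities in question have this form, with [e] the projection of the sum
    of the variables. *)

From mathcomp Require Import ssreflect ssrfun ssrbool.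
From Stdlib Require Import ProofIrrelevance.
Require Import Defs.

Set Implicit Arguments.
Unset Strict Implicit.
Unset Printing Implicit Defensive.

Local Open Scope brace_scope.

(** * Axioms in rewriting form *)

Section WeakBrace.

Variable S : weak_left_star_brace.
Implicit Types x y z : S.

Lemma addA x y z : x + (y + z) = x + y + z.
Proof. exact: (rss_assoc (badd_rss S)). Qed.

Lemma addNK x : x - x + x = x.
Proof. exact: (rss_regular (badd_rss S)). Qed.

Lemma oppK x : - (- x) = x.
Proof. exact: (rss_involutive (badd_rss S)). Qed.

Lemma oppD x y : - (x + y) = - y - x.
Proof. exact: (rss_antimorph (badd_rss S)). Qed.

Lemma mulA x y z : x * (y * z) = x * y * z.
Proof. exact: (rss_assoc (bmul_rss S)). Qed.

Lemma mulVK x : x * x^* * x = x.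
Proof. exact: (rss_regular (bmul_rss S)). Qed.

Lemma starK x : x^*^* = x.
Proof. exact: (rss_involutive (bmul_rss S)). Qed.

Lemma starM x y : (x * y)^* = y^* * x^*.
Proof. exact: (rss_antimorph (bmul_rss S)). Qed.

Lemma mulDr x y z : x * (y + z) = x * y - x + x * z.
Proof. exact: bmul_addr. Qed.

Lemma addNx x : - x + x = x * x^*.
Proof. exact: baddN_mulstar. Qed.

Lemma addKN x : - x + x - x = - x.
Proof. by rewrite -{2}[x]oppK addNK. Qed.

Lemma mulKV x : x^* * x * x^* = x^*.
Proof. by rewrite -{2}[x]starK mulVK. Qed.

End WeakBrace.

(** * Projections: the two orders agree, and products with them are sums *)

Section Projections.

Variable S : dual_weak_left_star_brace.
Implicit Types a b c d e f k t x y z : S.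

Lemma subxx x : x - x = x^* * x.
Proof. exact: dual_brace_axiom. Qed.

Definition projection e := - e + e = e.

Lemma proj_oppr e : projection e -> - e = e.
Proof. by move=> pe; rewrite -{1}pe oppD oppK pe. Qed.

Lemma proj_addxx e : projection e -> e + e = e.
Proof. by move=> pe; rewrite -{1}(proj_oppr pe) pe. Qed.

Lemma proj_star e : projection e -> e^* = e.
Proof. by move=> pe; rewrite -pe addNx starM starK. Qed.

Lemma proj_mulxx e : projection e -> e * e = e.
Proof. by move=> pe; rewrite -{2}(proj_star pe) -addNx pe. Qed.

Lemma projNx x : projection (- x + x).
Proof. by rewrite /projection oppD oppK addA addKN. Qed.

Lemma proj_subxx x : projection (x - x).
Proof. by rewrite -{1}[x]oppK; apply: projNx. Qed.

Lemma projVx x : projection (x^* * x).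
Proof. by rewrite -subxx; apply: proj_subxx. Qed.

(** The element is [x^* * x] for [x = f * e]. *)
Lemma proj_mul_sandwich e f :
  projection e -> projection f -> projection (e * f * e).
Proof.
move=> pe pf; rewrite -{1}(proj_star pe) -(proj_mulxx pf) -{1}(proj_star pf).
by rewrite mulA -starM -mulA; apply: projVx.
Qed.

Lemma proj_addNE e f : projection e -> projection f ->
  - (f + e) + (f + e) = e + f + e.
Proof.
move=> pe pf.
by rewrite oppD !proj_oppr // addA -[e + f + f]addA proj_addxx.
Qed.

Lemma proj_add_sandwich e f :
  projection e -> projection f -> projection (e + f + e).
Proof. by move=> pe pf; rewrite -proj_addNE //; apply: projNx. Qed.

Lemma proj_add_idem e f :
  projection e -> projection f -> e + f + e + f = e + f.
Proof.
move=> pe pf; rewrite -[RHS]addNK oppD !proj_oppr // !addA.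
by rewrite -[e + f + f]addA (proj_addxx pf) -[e + f + e + e]addA proj_addxx.
Qed.

Lemma proj_mul_le e k :
  projection e -> projection k -> e * k = k -> k * e = k.
Proof.
move=> pe pk h; rewrite -[LHS]starK starM (proj_star pe) (proj_star pk) h.
exact: proj_star.
Qed.

Lemma proj_add_le e k :
  projection e -> projection k -> e + k = k -> k + e = k.
Proof.
move=> pe pk h; rewrite -[LHS]oppK oppD (proj_oppr pe) (proj_oppr pk) h.
exact: proj_oppr.
Qed.

(** Distributing [e] over [k = k + k] gives [k + e + k = k]. This is the product of [e + k] with its
    star, so [e + k = k * (e + k)], which expands to [k]. *)
Lemma proj_le_mul_add e k :
  projection e -> projection k -> e * k = k -> e + k = k.
Proof.
move=> pe pk ek; have ke := proj_mul_le pe pk ek.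
have kek : k + e + k = k.
  by rewrite -[RHS]ek -[in RHS](proj_addxx pk) mulDr ek (proj_oppr pe).
rewrite -[LHS]mulVK -addNx proj_addNE // kek.
by rewrite mulDr ke proj_mulxx // addNK.
Qed.

(** Here [k * e] absorbs a summand [k] on its right, so expanding [k * (e + k)] leaves [k * e]. *)
Lemma proj_le_add_mul e k :
  projection e -> projection k -> e + k = k -> k * e = k.
Proof.
move=> pe pk ek.
have pkek := proj_mul_sandwich pk pe.
have kek : k * e * k + k = k * e * k.
  apply: proj_add_le => //; apply: proj_le_mul_add => //.
  by rewrite !mulA proj_mulxx.
have yk : k * e + k = k * e.
  have h : k * e + k * e * k = k * e.
    rewrite -[RHS]addNK -addA addNx starM !proj_star //.
    by rewrite !mulA -[k * e * e]mulA proj_mulxx.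
  by rewrite -{1}h -addA kek h.
by rewrite -{2}(proj_mulxx pk) -{3}ek mulDr (proj_oppr pk) (proj_mulxx pk) -addA
  proj_addxx.
Qed.

Lemma proj_mul_sandwichE e f : projection e -> projection f ->
  e * f * e = e + f + e /\ e * f = f + e.
Proof.
suff h e' f' : projection e' -> projection f' ->
    [/\ e' * f' * e' = e' + f' + e', f' + e' * f' = e' * f'
      & e' + e' * f' = e' + f' + e'].
  move=> pe pf; have [h1 h2 h3] := h _ _ pe pf; have [h4 _ _] := h _ _ pf pe.
  (* In [x - x + x] with [x = e * f], the part [x - x] is [f * e * f], which the claim for the
     swapped pair turns into [f + e + f]. *)
  split=> //; rewrite -[LHS]addNK subxx starM !proj_star // mulA.
  rewrite -[f * e * e]mulA proj_mulxx // h4 -addA h2 -addA h3 !addA.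
  exact: proj_add_idem.
move=> pe pf; set x := e' * f'; set n := e' + f' + e'.
have pn : projection n by apply: proj_add_sandwich.
have en : e' * n = n.
  have en' : e' + n = n by rewrite /n !addA proj_addxx.
  by rewrite -[LHS]starK starM !proj_star // proj_le_add_mul // proj_star.
have nE : n = e' + x + e'.
  by rewrite -{1}en /n mulDr mulDr !proj_oppr // proj_mulxx // !proj_addxx //
    -addA proj_addxx.
have px : - x + x = e' * f' * e'.
  by rewrite addNx starM !proj_star // mulA -[e' * f' * f']mulA proj_mulxx.
have qx : x - x = f' * e' * f'.
  by rewrite subxx starM !proj_star // mulA -[f' * e' * e']mulA proj_mulxx.
have pefe := proj_mul_sandwich pe pf; have pfef := proj_mul_sandwich pf pe.
have xe : x + e' = x.
  have h : e' * f' * e' + e' = e' * f' * e'.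
    apply: proj_add_le => //; apply: proj_le_mul_add => //.
    by rewrite !mulA proj_mulxx.
  have xp : x + e' * f' * e' = x by rewrite -px addA addNK.
  by rewrite -{1}xp -addA h.
have fx : f' + x = x.
  have h : f' + f' * e' * f' = f' * e' * f'.
    by apply: proj_le_mul_add => //; rewrite !mulA proj_mulxx.
  by rewrite -{1}[x]addNK qx addA h -qx addNK.
have ex : e' + x = n by rewrite nE -addA xe.
have xx : x + x = x.
  have : e' * (f' + f') = x + x by rewrite mulDr (proj_oppr pe) -/x xe.
  by rewrite proj_addxx // => <-.
have xn : x + n = x by rewrite -ex addA xe xx.
have nx : n + x = n by rewrite -ex -addA xx.
(* The projections [p = - x + x] and [n] coincide, since [n + p] equals both of them. *)
split=> //; rewrite -px.
have pn' : - x + x + n = - x + x by rewrite -addA xn.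
have np : n + (- x + x) = - x + x.
  have pp := projNx x; move: pn'; set p := - x + x => pn'.
  by have := congr1 (@bopp S) pn'; rewrite oppD (proj_oppr pn) (proj_oppr pp).
by rewrite -np -{1}nx -addA [x + _]addA addNK nx.
Qed.

(** The product [n] of [y + e] with its star satisfies [e * n = n], hence [y + e = e * (y + e)].
    This expands to [e * y + e], and [e * y] absorbs the last [e]. *)
Lemma proj_mulr e y : projection e -> e * y = y + e.
Proof.
move=> pe; have pp := projNx y; have pn := proj_add_sandwich pe pp.
set n := e + (- y + y) + e in pn.
have nV : e * y * (e * y)^* = n.
  rewrite starM (proj_star pe) mulA -[e * y * _]mulA -addNx.
  by case: (proj_mul_sandwichE pe pp).
have eye : e * y + e = e * y.
  have h : e * y + n = e * y by rewrite -nV -addNx addA addNK.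
  by rewrite -{1}h -addA /n -[_ + e + e]addA proj_addxx.
have en : e * n = n.
  rewrite -[LHS]starK starM (proj_star pe) (proj_star pn).
  by rewrite proj_le_add_mul // ?proj_star // /n !addA proj_addxx.
have nE : n = (y + e) * (y + e)^*.
  by rewrite -addNx oppD (proj_oppr pe) /n !addA.
rewrite -[RHS]mulVK -nE -[in RHS]en -mulA nE mulVK mulDr proj_oppr //.
by rewrite eye (proj_mulxx pe) eye.
Qed.

(** Expanding [y * e * y^*] identifies [- y + y * e] with the projection [- (y * e) + y * e]. A
    projection is its own opposite, so the last term of [y * e - y * e + y * e] may be replaced by
    [y]. *)
Lemma proj_mull e y : projection e -> y * e = e + y.
Proof.
move=> pe; have pq := proj_subxx y.
have h : - y + y * e = y * e * (y * e)^*.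
  rewrite starM (proj_star pe) mulA -[y * e * e]mulA proj_mulxx //.
  by rewrite -mulA [e * y^*]proj_mulr // mulDr -addNx addKN.
have h' : - (y * e) + y = - (y * e) + y * e.
  by rewrite -[RHS](proj_oppr (projNx _)) addNx -h oppD oppK.
rewrite -[LHS]addNK -addA -h' addA subxx starM (proj_star pe) mulA.
rewrite -[e * y^* * y]mulA -subxx.
have [-> _] := proj_mul_sandwichE pe pq.
by rewrite -{3}[y]addNK addA proj_add_idem // -addA addNK.
Qed.

(** * Projections in the interior of sums *)

(** Left distributivity for [e * (y + z)], read through [e * y = y + e]. *)
Lemma proj_add_insr e y z : projection e -> y + z + e = y + e + z + e.
Proof.
move=> pe; rewrite -proj_mulr // mulDr !proj_mulr // proj_oppr //.
by rewrite -[y + e + e]addA (proj_addxx pe) addA.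
Qed.

Lemma proj_add_insl e y z : projection e -> e + y + z = e + y + e + z.
Proof.
move=> pe; have := congr1 (@bopp S) (proj_add_insr (- z) (- y) pe).
by rewrite !oppD !oppK (proj_oppr pe) !addA.
Qed.

Lemma proj_add_central e c y d : projection e -> c + e + y + d = c + y + e + d.
Proof.
move=> pe; rewrite (proj_add_insr c y pe) -!addA; congr (c + _).
by rewrite !addA; apply: proj_add_insl.
Qed.

Lemma star_mulxx_add x y : y^* * y + x * y = x * y.
Proof. by rewrite -(proj_mull _ (projVx y)) -mulA [y * (_ * _)]mulA mulVK. Qed.

Lemma mul_addNx x y : x * y + x * x^* = x * y.
Proof. by rewrite -addNx -(proj_mulr _ (projNx x)) addNx mulA mulVK. Qed.

(** * The order of interior projections *)

Section Below.

(* Modulo the ends of a sum, [below t x] says that the projection of [t] lies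
   under the projection of [x] in the semilattice of interior projections. *)
Definition below t x := forall c d, c + (x - x) + t + d = c + t + d.

Lemma below_refl x : below x x.
Proof. by move=> c d; rewrite -[c + _ + x]addA addNK. Qed.

Lemma below_addl t s x : below t x -> below (t + s) x.
Proof.
by move=> tx c d; have := tx c (s + d); move: (x - x) => q; rewrite !addA.
Qed.

Lemma below_addr s t x : below t x -> below (s + t) x.
Proof.
move=> tx c d; have := tx (c + s) d; move: (x - x) (proj_subxx x) => q pq.
by have := proj_add_central c s (t + d) pq; rewrite !addA => -> ->.
Qed.

Lemma below_opp t x : below t x -> below (- t) x.
Proof.
move=> tx c d; have := congr1 (@bopp S) (tx (- d) (- c)).
move: (x - x) (proj_subxx x) => q pq; rewrite proj_add_central //.
by rewrite !oppD !oppK (proj_oppr pq) !addA.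
Qed.

(** By absorption [t * s = t * s + (- t + t)], a sum in which [t] occurs. *)
Lemma below_mull t s x : below t x -> below (t * s) x.
Proof.
by move=> tx; rewrite -mul_addNx -addNx; apply/below_addr/below_addl/below_opp.
Qed.

Lemma below_mulr s t x : below t x -> below (s * t) x.
Proof.
by move=> tx; rewrite -star_mulxx_add -subxx; do 2!apply: below_addl.
Qed.

Lemma below_star t x : below t x -> below (t^*) x.
Proof. by move=> tx; rewrite -mulKV -mulA; apply/below_mulr/below_mull. Qed.

Lemma below_add t x y : below t x -> below t y -> below t (x + y).
Proof.
move=> tx ty c d; rewrite -[RHS]tx -[RHS]ty oppD [x + y + _]addA.
rewrite -[x + y - y]addA.
have := proj_add_central (c + x) (- x) (t + d) (proj_subxx y).
by move: (y - y) => q; rewrite !addA.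
Qed.

End Below.

(** * Compression by a projection *)

Section Localization.

Variable e : S.
Hypothesis pe : projection e.

Definition local x := e * x * e.

Lemma localE x : local x = e + x + e.
Proof. by rewrite /local proj_mull // proj_mulr // addA. Qed.

Lemma local_add x y : local (x + y) = local x + local y.
Proof.
rewrite !localE !addA -[e + x + e + e]addA proj_addxx //.
by rewrite -(proj_add_insl _ _ pe).
Qed.

Lemma local_opp x : local (- x) = - local x.
Proof. by rewrite !localE !oppD (proj_oppr pe) addA. Qed.

Lemma local_star x : local (x^*) = (local x)^*.
Proof. by rewrite /local !starM (proj_star pe) mulA. Qed.

(** The right side compresses [x * (e * y) = x * y - x + e + x]. Beside the outer [e] the interior
    one is redundant, and [x * y] absorbs [- x + x]. *)
Lemma local_mul x y : local (x * y) = local x * local y.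
Proof.
have -> : local x * local y = local (x * (e * y)).
  by rewrite /local !mulA -[e * x * e * e]mulA proj_mulxx.
rewrite (proj_mulr y pe) mulDr (proj_mull x pe) !localE //.
rewrite -{1}mul_addNx -addNx !addA.
exact: proj_add_insr.
Qed.

Lemma local_local x : local (local x) = local x.
Proof. by rewrite !localE !addA proj_addxx // -addA proj_addxx. Qed.

End Localization.

End Projections.

(** * The skew left brace attached to a projection *)

Section LocalBrace.

Variables (S : dual_weak_left_star_brace) (e : S).
Hypothesis pe : projection e.

(** The two additive conditions also say [x^* * x = e] and [x * x^* = e], so both operations become
    groups with neutral element [e]. *)
Record unit_class := UnitClass {
  unit_val : S;
  unit_subxx : unit_val - unit_val = e;
  unit_addNx : - unit_val + unit_val = e
}.

Lemma unit_val_inj x y : unit_val x = unit_val y -> x = y.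
Proof.
case: x y => [x xq xp] [y yq yp] /= exy; subst y.
by rewrite (proof_irrelevance _ xq yq) (proof_irrelevance _ xp yp).
Qed.

Lemma unit_addr (x : unit_class) : unit_val x + e = unit_val x.
Proof. by rewrite -(unit_addNx x) addA addNK. Qed.

Lemma unit_addl (x : unit_class) : e + unit_val x = unit_val x.
Proof. by rewrite -(unit_subxx x) addNK. Qed.

Lemma local_unit (x : unit_class) : local e (unit_val x) = unit_val x.
Proof. by rewrite localE // unit_addl unit_addr. Qed.

Lemma unit_opp_subproof (x : unit_class) :
  let y := - unit_val x in y - y = e /\ - y + y = e.
Proof. by rewrite /= oppK unit_addNx unit_subxx. Qed.

Lemma unit_star_subproof (x : unit_class) :
  let y := (unit_val x)^* in y - y = e /\ - y + y = e.
Proof.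
by rewrite /= subxx addNx starK -addNx -subxx unit_addNx unit_subxx.
Qed.

Lemma unit_add_subproof (x y : unit_class) :
  let z := unit_val x + unit_val y in z - z = e /\ - z + z = e.
Proof.
rewrite /= oppD !addA -[_ + unit_val y - unit_val y]addA unit_subxx unit_addr.
by rewrite -[_ - unit_val x + _]addA unit_addNx -addA unit_addl
  unit_addNx unit_subxx.
Qed.

Lemma unit_mul_subproof (x y : unit_class) :
  let z := unit_val x * unit_val y in z - z = e /\ - z + z = e.
Proof.
rewrite /= subxx addNx starM !mulA.
rewrite -[_ * unit_val y * _]mulA -addNx unit_addNx.
rewrite -[_ * unit_val x]mulA -subxx unit_subxx.
by rewrite -mulA (proj_mulr _ pe) unit_addr -subxx unit_subxx
  (proj_mull _ pe) unit_addl -addNx unit_addNx.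
Qed.

Definition unit_opp x :=
  UnitClass (unit_opp_subproof x).1 (unit_opp_subproof x).2.

Definition unit_star x :=
  UnitClass (unit_star_subproof x).1 (unit_star_subproof x).2.

Definition unit_add x y :=
  UnitClass (unit_add_subproof x y).1 (unit_add_subproof x y).2.

Definition unit_mul x y :=
  UnitClass (unit_mul_subproof x y).1 (unit_mul_subproof x y).2.

Lemma unit_add_rss : regular_star_semigroup unit_add unit_opp.
Proof.
split=> [x y z|x|x|x y]; apply: unit_val_inj => /=;
  [exact: addA | exact: addNK | exact: oppK | exact: oppD].
Qed.

Lemma unit_mul_rss : regular_star_semigroup unit_mul unit_star.
Proof.
split=> [x y z|x|x|x y]; apply: unit_val_inj => /=;
  [exact: mulA | exact: mulVK | exact: starK | exact: starM].
Qed.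

Lemma unit_mul_addr x y z :
  unit_mul x (unit_add y z) =
    unit_add (unit_add (unit_mul x y) (unit_opp x)) (unit_mul x z).
Proof. by apply: unit_val_inj; apply: mulDr. Qed.

Lemma unit_addN_mulstar x : unit_add (unit_opp x) x = unit_mul x (unit_star x).
Proof. by apply: unit_val_inj; apply: addNx. Qed.

Definition unit_weak_brace :=
  WeakLeftStarBrace unit_add_rss unit_mul_rss unit_mul_addr unit_addN_mulstar.

Lemma unit_dual_axiom (x : unit_weak_brace) : x - x = x^* * x.
Proof. by apply: unit_val_inj; apply: subxx. Qed.

Definition unit_brace := DualWeakLeftStarBrace unit_dual_axiom.

Lemma unit_brace_subxx (x y : unit_brace) : x - x = y - y.
Proof. by apply: unit_val_inj; rewrite /= !unit_subxx. Qed.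

Lemma local_unit_class x : below e x ->
  local e x - local e x = e /\ - local e x + local e x = e.
Proof.
move=> ex; have qe : local e (x - x) = e.
  by rewrite localE //; have := ex e e; rewrite -addA !(proj_addxx pe).
rewrite -!local_opp // -!local_add //; split=> //.
(* In the interior of a sum, [- x + x] placed before [x - x] moves between [x] and [- x], where it
   is absorbed. *)
have ppq : local e (- x + x + (x - x)) = e.
  have h := proj_add_central e x (- x + e) (projNx x).
  rewrite -[RHS]qe !localE // -{3}(addKN x) !addA.
  by move: h; rewrite !addA.
rewrite -[RHS]ppq (local_add pe (- x + x) (x - x)) qe !localE //.
by rewrite -[RHS]addA (proj_addxx pe).
Qed.

End LocalBrace.

(** * The theorem for skew left braces *)

Section SkewBrace.

Variables (G : dual_weak_left_star_brace) (o : G).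
Hypothesis subo : forall x : G, x - x = o.
Implicit Types a b c x y z : G.

Lemma skew_addNx x : - x + x = o.
Proof. by rewrite -(subo (- x)) oppK. Qed.

Lemma skew_add0 x : o + x = x.
Proof. by rewrite -(subo x) addNK. Qed.

Lemma skew_addr0 x : x + o = x.
Proof. by rewrite -(skew_addNx x) addA addNK. Qed.

Lemma skew_mulV x : x * x^* = o.
Proof. by rewrite -addNx skew_addNx. Qed.

Lemma skew_mulVx x : x^* * x = o.
Proof. by rewrite -subxx subo. Qed.

Lemma skew_mul1 x : o * x = x.
Proof. by rewrite -(skew_mulV x) mulVK. Qed.

Lemma skew_mulr1 x : x * o = x.
Proof. by rewrite -(skew_mulVx x) mulA mulVK. Qed.

Lemma skew_addrK x y : y + x - x = y.
Proof. by rewrite -addA subo skew_addr0. Qed.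

Lemma skew_addrNK x y : y - x + x = y.
Proof. by rewrite -addA skew_addNx skew_addr0. Qed.

Lemma skew_mulrK x y : y * x * x^* = y.
Proof. by rewrite -mulA skew_mulV skew_mulr1. Qed.

Lemma skew_mulrVK x y : y * x^* * x = y.
Proof. by rewrite -mulA skew_mulVx skew_mulr1. Qed.

Lemma skew_addI x y z : x + y = x + z -> y = z.
Proof.
move=> h; rewrite -[y]skew_add0 -(skew_addNx x) -addA h addA.
by rewrite skew_addNx skew_add0.
Qed.

Lemma skew_mulrN x y : x * (- y) = x - x * y + x.
Proof.
have : x * (y - y) = x by rewrite subo skew_mulr1.
rewrite mulDr => h; apply: (@skew_addI (x * y - x)).
by rewrite h !addA skew_addrNK subo skew_add0.
Qed.

Lemma skew_mul_subl x y z : x * (- y + z) = x - x * y + x * z.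
Proof. by rewrite mulDr skew_mulrN skew_addrK. Qed.

Variable z : G.

Lemma skew_sigmaE a b : sigma z a b = - (a * z) + a * b * z.
Proof. by rewrite /sigma skew_mulVx skew_mul1 skew_mulrVK. Qed.

(** The composite depends on [x] and [y] only through [x * y]. As the deformed map preserves
    products, this yields the first component of the braid relation. *)
Lemma skew_sigma_sigma x y t : right_distributor z ->
  sigma z x (sigma z y t) = - (x * y * z * z) + x * y * t * z * z.
Proof.
move=> zD; have zN m : - m * z = z - m * z + z.
  have : (m - m) * z = z by rewrite subo skew_mul1.
  rewrite zD => h; apply: (@skew_addI (m * z - z)).
  by rewrite h !addA skew_addrNK subo skew_add0.
rewrite skew_sigmaE [sigma z y t]skew_sigmaE -mulA zD zN skew_addrK.
rewrite -addA mulDr skew_mul_subl !mulA !addA skew_addrNK.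
by rewrite skew_addNx skew_add0.
Qed.

Lemma skew_sigma_tau a b : sigma z a b * tau z b a = a * b.
Proof. by rewrite /tau !mulA skew_mulV skew_mul1. Qed.

(** The second component, with [u], [v] for [sigma z a b], [tau z b a] and [y], [x] for
    [sigma z b c], [sigma z a y]. *)
Lemma skew_middle a b c u v x y :
  u = - (a * z) + a * b * z -> u * v = a * b -> x = - (a * z) + a * y * z ->
  x^* * u * (- (v * z) + v * c * z)
    = - (x^* * a * y * z) + x^* * a * y * (y^* * b * c) * z.
Proof.
move=> uE uv xE; rewrite -mulA skew_mul_subl !mulA uv {1}uE skew_addrK.
rewrite skew_mul_subl !mulA skew_mulrK; congr (_ + _).
have ayz : a * y * z = a * z + x by rewrite xE addA subo skew_add0.
rewrite -!mulA [a * (y * z)]mulA ayz mulDr skew_mulVx skew_addr0.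
by rewrite oppD oppK.
Qed.

(** Both sides cancel to [w^* * u^* * a * b * c]: since products are preserved, the third component
    follows from the other two. *)
Lemma skew_last a b c u w x y :
  w^* * (u^* * a * b) * c = (x^* * u * w)^* * (x^* * a * y) * (y^* * b * c).
Proof. by rewrite !starM starK !mulA !skew_mulrK. Qed.

Lemma skew_distributor_yang_baxter (a b c : G) : right_distributor z ->
  [/\ sigma z (sigma z a b) (sigma z (tau z b a) c) = sigma z a (sigma z b c),
      tau z (sigma z (tau z b a) c) (sigma z a b) =
        sigma z (tau z (sigma z b c) a) (tau z c b)
    & tau z c (tau z b a) = tau z (tau z c b) (tau z (sigma z b c) a)].
Proof.
move=> zD.
have e1 : sigma z (sigma z a b) (sigma z (tau z b a) c) =
    sigma z a (sigma z b c).
  by rewrite !skew_sigma_sigma // skew_sigma_tau.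
have e2 : tau z (sigma z (tau z b a) c) (sigma z a b) =
    sigma z (tau z (sigma z b c) a) (tau z c b).
  transitivity ((sigma z a (sigma z b c))^* * sigma z a b
    * sigma z (tau z b a) c).
    by rewrite -e1.
  rewrite [sigma z (tau z b a) c]skew_sigmaE [RHS]skew_sigmaE.
  exact: skew_middle (skew_sigmaE _ _) (skew_sigma_tau _ _) (skew_sigmaE _ _).
split=> //.
transitivity ((tau z (sigma z (tau z b a) c) (sigma z a b))^*
  * tau z (sigma z b c) a * tau z c b); last by rewrite e2.
transitivity (((sigma z a (sigma z b c))^* * sigma z a b
    * sigma z (tau z b a) c)^*
  * tau z (sigma z b c) a * tau z c b); last by rewrite -e1.
exact: skew_last.
Qed.

Lemma skew_yang_baxter_distributor :
  (forall a b c : G,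
    sigma z (sigma z a b) (sigma z (tau z b a) c) = sigma z a (sigma z b c)) ->
  right_distributor z.
Proof.
move=> H.
(* The triple [(a, o, c)] says that [t |-> - z + t z] commutes with
   [t |-> - a + a t]; [c] is chosen so that [c z = z + a^* y]. *)
have zS a y : (- a + y) * z = z - a * z + y * z.
  have := H a o ((z + a^* * y) * z^*).
  rewrite /tau !skew_sigmaE !skew_mulr1 !skew_addNx.
  have -> : o^* = o by rewrite -{2}(skew_mulV o) skew_mul1.
  rewrite !skew_mul1 skew_mulrVK [a * (_ * z^*)]mulA skew_mulrVK.
  rewrite mulDr [- z + (z + _)]addA !skew_addNx !skew_add0 !mulA.
  rewrite skew_mulV skew_mul1 !addA skew_addNx skew_add0 => h.
  by apply: (@skew_addI (- z)); rewrite h !addA skew_addNx skew_add0.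
move=> a b; rewrite -{1}[a]oppK zS; congr (_ + _).
(* The case [y = o] gives [a * z = z - (- a) * z + z], which trades the opposite of [(- a) * z] for
   [a * z]. *)
have := zS (- a) o; rewrite oppK skew_addr0 skew_mul1 => ->.
by rewrite skew_addrK.
Qed.

End SkewBrace.

(** * Lifting identities from the skew left brace *)

Section Lifting.

Variables (S : dual_weak_left_star_brace) (z : S).
Implicit Types a b c e f g k t u v w x y : S.

(** The frame makes [e] interior, so it can be inserted on both sides:
    [t = f + t + g = f + e + t + e + g] for [t] either element. *)
Lemma local_inj e f g x y : projection e -> below x e -> below y e ->
  f + x + g = x -> f + y + g = y -> local e x = local e y -> x = y.
Proof.
move=> pe.
suff framed t : below t e -> f + t + g = t -> f + local e t + g = t.
  by move=> xe ye fx fy exy; rewrite -(framed _ xe fx) exy framed.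
move=> te ft; rewrite -[RHS]ft -(te f g) (proj_oppr pe) (proj_addxx pe).
rewrite localE // !addA -(proj_add_central (f + e) t g pe).
by rewrite -[f + e + e]addA (proj_addxx pe).
Qed.

Lemma below_subxx t x : below t x -> below t (x - x).
Proof.
move=> tx c d; have pq := proj_subxx x.
by rewrite (proj_oppr pq) (proj_addxx pq).
Qed.

Lemma local_sigma e a b : projection e ->
  local e (sigma z a b) = sigma (local e z) (local e a) (local e b).
Proof.
move=> pe; rewrite /sigma.
by rewrite !(local_mul pe, local_add pe, local_opp pe, local_star pe).
Qed.

Lemma local_tau e a b : projection e ->
  local e (tau z b a) = tau (local e z) (local e b) (local e a).
Proof.
by move=> pe; rewrite /tau !(local_mul pe) (local_star pe) local_sigma.
Qed.

Lemma sigmaE a b : sigma z a b = local (z^* * z) (- (a * z) + a * b * z).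
Proof. by rewrite /sigma /local !mulA. Qed.

Lemma sigma_framed a b : z^* * z + sigma z a b + z^* * z = sigma z a b.
Proof.
by rewrite -(localE (projVx z)) sigmaE local_local //; apply: projVx.
Qed.

Lemma sigma_mulr a b : sigma z a b * (z^* * z) = sigma z a b.
Proof. by rewrite sigmaE /local -mulA proj_mulxx //; apply: projVx. Qed.

Lemma tau_mulr k a b : b * k = b -> tau z b a * k = tau z b a.
Proof. by rewrite /tau -mulA => ->. Qed.

(** The last factor [b] absorbs [k] and the first, the star of a [sigma], absorbs [z^* * z]. The
    sides are exchanged because [y * e = e + y] and [e * y = y + e]. *)
Lemma tau_framed k a b : projection k -> b * k = b ->
  k + tau z b a + z^* * z = tau z b a.
Proof.
move=> pk bk; rewrite -(proj_mull _ pk) tau_mulr // -(proj_mulr _ (projVx z)).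
rewrite /tau !mulA; congr (_ * _ * _).
by rewrite -[in RHS]sigma_mulr starM (proj_star (projVx z)).
Qed.

Lemma below_sigmal a b x : below a x -> below (sigma z a b) x.
Proof.
move=> ax; do 2!apply: below_mull.
exact/below_mulr/below_addl/below_opp/below_mull.
Qed.

Lemma below_sigmar a b x : below b x -> below (sigma z a b) x.
Proof.
move=> bx; do 2!apply: below_mull.
exact/below_mulr/below_addr/below_mull/below_mulr.
Qed.

Lemma below_sigmaz a b x : below z x -> below (sigma z a b) x.
Proof. by move=> zx; apply/below_mulr. Qed.

Lemma below_taul a b x : below a x -> below (tau z b a) x.
Proof. by move=> ax; apply/below_mull/below_mulr. Qed.

Lemma below_taur a b x : below b x -> below (tau z b a) x.
Proof. by move=> bx; apply/below_mulr. Qed.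

Lemma below_tauz a b x : below z x -> below (tau z b a) x.
Proof. by move=> zx; do 2!apply: below_mull; apply/below_star/below_sigmaz. Qed.

#[local] Hint Resolve below_refl below_addl below_addr below_mull below_mulr
  below_opp below_sigmal below_sigmar below_sigmaz below_taul below_taur
  below_tauz : below.

Lemma yang_baxterE : yang_baxter_solution (deformed_map z) <-> forall a b c,
  [/\ sigma z (sigma z a b) (sigma z (tau z b a) c) = sigma z a (sigma z b c),
      tau z (sigma z (tau z b a) c) (sigma z a b) =
        sigma z (tau z (sigma z b c) a) (tau z c b)
    & tau z c (tau z b a) = tau z (tau z c b) (tau z (sigma z b c) a)].
Proof.
split=> [H a b c | H [[a b] c]]; first by case: (H (a, b, c)).
by case: (H a b c) => /= -> -> ->.
Qed.

(** The underlying element, inferred from the two proofs, is [local e x]. *)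
Definition unit_of e (pe : projection e) x (ex : below e x) : unit_brace pe :=
  UnitClass (local_unit_class pe ex).1 (local_unit_class pe ex).2.

Lemma right_distributor_unit_of e (pe : projection e) (ez : below e z) :
  right_distributor z -> right_distributor (unit_of pe ez).
Proof.
move=> zD a b; apply: unit_val_inj => /=.
have := congr1 (local e) (zD (unit_val a) (unit_val b)).
by rewrite !(local_mul pe, local_add pe, local_opp pe, local_unit).
Qed.

Lemma right_distributor_yang_baxter :
  right_distributor z -> yang_baxter_solution (deformed_map z).
Proof.
move=> zD; apply/yang_baxterE => a b c.
(* This [e] lies under every variable, so all of them compress into its class. A term containing all
   four variables lies under [e] in turn. *)
pose w := a + b + c + z; pose e := w - w.
have pe : projection e by apply: proj_subxx.
have ea : below e a by rewrite /e /w; auto 6 with below.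
have eb : below e b by rewrite /e /w; auto 6 with below.
have ec : below e c by rewrite /e /w; auto 6 with below.
have ez : below e z by rewrite /e /w; auto 6 with below.
have te t : below t a -> below t b -> below t c -> below t z -> below t e.
  move=> ta tb tc tz; apply: below_subxx.
  exact: below_add (below_add (below_add ta tb) tc) tz.
pose Z := unit_of pe ez.
have [e1 e2 e3] := @skew_distributor_yang_baxter _ (Z - Z)
  (fun X => unit_brace_subxx X Z) Z (unit_of pe ea) (unit_of pe eb)
  (unit_of pe ec) (right_distributor_unit_of ez zD).
split.
- apply: (local_inj pe _ _ (sigma_framed _ _) (sigma_framed _ _)).
  1,2: by apply: te; auto 8 with below.
  by rewrite !(local_sigma, local_tau) //; apply: (congr1 (@unit_val S e) e1).
- apply: (local_inj pe _ _ (tau_framed _ (projVx z) (sigma_mulr _ _))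
    (sigma_framed _ _)).
  1,2: by apply: te; auto 8 with below.
  by rewrite !(local_sigma, local_tau) //; apply: (congr1 (@unit_val S e) e2).
(* Both sides of the third component absorb [c^* * c] on the right as a factor, so this is their
   left frame. *)
have cc : c * (c^* * c) = c by rewrite mulA mulVK.
apply: (local_inj pe _ _ (tau_framed _ (projVx c) cc)
  (tau_framed _ (projVx c) (tau_mulr _ cc))).
1,2: by apply: te; auto 8 with below.
by rewrite !(local_sigma, local_tau) //; apply: (congr1 (@unit_val S e) e3).
Qed.

Lemma yang_baxter_right_distributor :
  yang_baxter_solution (deformed_map z) -> right_distributor z.
Proof.
move=> /yang_baxterE H a b.
pose w := a + b + z; pose e := w - w.
have pe : projection e by apply: proj_subxx.
have ea : below e a by rewrite /e /w; auto 6 with below.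
have eb : below e b by rewrite /e /w; auto 6 with below.
have ez : below e z by rewrite /e /w; auto 6 with below.
have te t : below t a -> below t b -> below t z -> below t e.
  move=> ta tb tz; apply: below_subxx.
  exact: below_add (below_add ta tb) tz.
pose Z := unit_of pe ez.
have ZD : right_distributor Z.
  apply: (@skew_yang_baxter_distributor _ (Z - Z)
    (fun X => unit_brace_subxx X Z)) => A B C; apply: unit_val_inj.
  (* Compression fixes the elements of the class and sends [z] to the value of [Z]. *)
  have [h _ _] := H (unit_val A) (unit_val B) (unit_val C).
  have := congr1 (local e) h.
  by rewrite !(local_sigma, local_tau) // !local_unit.
(* A product ending in [z] absorbs [z^* * z] on the left. On the right, [b * z] and [(a + b) * z]
   both absorb [- b + b]. *)
apply: (local_inj (e := e) (f := z^* * z) (g := - b + b)) => //.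
1,2: by apply: te; auto with below.
- rewrite star_mulxx_add -mul_addNx -addNx -addA; congr (_ + _).
  by rewrite oppD !addA -[_ + b - b]addA -[_ + (b - b) + b]addA addNK.
- by rewrite (addNx b) !addA star_mulxx_add -addA mul_addNx.
rewrite !(local_mul pe, local_add pe, local_opp pe).
exact: (congr1 (@unit_val S e) (ZD (unit_of pe ea) (unit_of pe eb))).
Qed.

End Lifting.

Theorem theorem4p6 (S : dual_weak_left_star_brace) (z : S) :
  yang_baxter_solution (deformed_map z) <-> right_distributor z.
Proof.
split; first exact: yang_baxter_right_distributor.
exact: right_distributor_yang_baxter.
Qed.
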